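(* Let $n\ge1$, let $a_1,\dots,a_n,b_1,\dots,b_n$ be real numbers with $y=\sum_{i=1}^n a_ib_i\neq0$, and let $\widehat y$ be the value of $y$ computed by sequential (left-to-right) evaluation under SR-nearness with $u=\beta^{1-p}$, that is $\widehat y=\widehat s_n$ where $\widehat s_1=a_1b_1(1+\delta_1)$ and $\widehat s_i=(\widehat s_{i-1}+a_ib_i(1+\delta_{2i-2}))(1+\delta_{2i-1})$ for $2\le i\le n$, with $\delta_{2i-2}$ and $\delta_{2i-1}$ the SR-nearness relative errors of the $i$th product and of the corresponding addition (and $\delta_1$ that of the product $a_1b_1$). Then $E(\widehat y)=y$ and $$V(\widehat y)\le y^2\,\mathcal K_1^2\,\gamma_n(u^2),$$ where $\mathcal K_1=\dfrac{\sum_{i=1}^n|a_ib_i|}{\left|\sum_{i=1}^n a_ib_i\right|}$ and $\gamma_n(u^2)=(1+u^2)^n-1$.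
   Context: Floating-point numbers: fix a base $\beta\ge2$ and precision $p\ge1$ (integers); $\mathcal F$ is the set of normal floating-point numbers $\pm m\beta^{e-p}$ with $m,e$ integers and $\beta^{p-1}\le m<\beta^p$ (underflow and overflow are ignored, so $e$ ranges over all integers). Put $u=\beta^{1-p}$. For real $x\ne0$, $\lceil x\rceil=\min\{y\in\mathcal F:y\ge x\}$, $\lfloor x\rfloor=\max\{y\in\mathcal F:y\le x\}$, and, for $x\notin\mathcal F$, $\theta(x)=(x-\lfloor x\rfloor)/(\lceil x\rceil-\lfloor x\rfloor)$. SR-nearness (stochastic rounding): for $x\notin\mathcal F\cup\{0\}$, $\mathrm{fl}(x)=\lceil x\rceil$ with probability $\theta(x)$ and $\mathrm{fl}(x)=\lfloor x\rfloor$ with probability $1-\theta(x)$; if $x\in\mathcal F\cup\{0\}$, $\mathrm{fl}(x)=x$. In a sequence of elementary operations $c_k\leftarrow a_k\,\mathrm{op}_k\,b_k$, $\mathrm{op}_k\in\{+,-,*,/\}$, whose operands are data or previously computed values, each rounding is made with these probabilities conditionally on all previous roundings. The relative error $\delta_k$ of the $k$th operation is defined by $\widehat c_k=\mathrm{fl}(\widehat a_k\,\mathrm{op}_k\,\widehat b_k)=(\widehat a_k\,\mathrm{op}_k\,\widehat b_k)(1+\delta_k)$, with $\delta_k=0$ when the exact result is $0$. It is known that $|\delta_k|\le u$ and $\mathbb{E}[\delta_k\mid\delta_1,\dots,\delta_{k-1}]=\mathbb{E}(\delta_k)=0$ for all $k$ (mean independence). Here the operations are performed in the order of the indices $1,2,\dots,2n-1$,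 and input data are used exactly. $E$ and $V$ denote expectation and variance. *)

(* Defs.v *)
From HB Require Import structures.
From mathcomp Require Import all_boot all_order all_algebra.
From mathcomp Require Import all_classical all_reals all_analysis.

Set Implicit Arguments.
Unset Strict Implicit.
Unset Printing Implicit Defensive.

Import Order.TTheory GRing.Theory Num.Theory.
Local Open Scope classical_set_scope.
Local Open Scope ring_scope.

Section FloatingPoint.
Context {R : realType} (beta p : nat).

(* Normal numbers only: 0 is not an element, and the exponent is unbounded. *)
Definition float : set R :=
  [set x | exists (m : nat) (e : int),
     (beta ^ p.-1 <= m < beta ^ p)%N /\
     (x = m%:R * beta%:R ^ (e - p%:Z) \/ x = - (m%:R * beta%:R ^ (e - p%:Z)))].

Definition unit_roundoff : R := beta%:R ^ (1 - p%:Z).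

(* The value is 0 when A has no minimum (resp. maximum); this does not occur
   below for x != 0, 1 < beta and 0 < p. *)
Definition set_min (A : set R) : R := xget 0 (A `&` lbound A).
Definition set_max (A : set R) : R := xget 0 (A `&` ubound A).

Definition round_up (x : R) : R := set_min [set y | float y /\ x <= y].
Definition round_down (x : R) : R := set_max [set y | float y /\ y <= x].

Definition theta (x : R) : R :=
  (x - round_down x) / (round_up x - round_down x).

(* The probability that fl(x) = w under SR-nearness. *)
Definition sr_prob (x w : R) : R :=
  if x \in float `|` [set 0] then (w == x)%:R
  else if w == round_up x then theta x
  else if w == round_down x then 1 - theta x
  else 0.

(* delta 1, ..., delta N are the relative errors of N successive operations
   under SR-nearness. The exact result of the kth operation on the computed
   operands is [exact k e] when the errors made so far are e 1, ..., e k.-1; the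
   instance below does not read e at any index j >= k. The last conjunct is the
   law of the kth rounding conditional on the previous ones, multiplied by the
   probability of the conditioning event. That event may be taken in this
   elementary form because the errors take finitely many values almost surely. *)
Definition sr_errors {d : measure_display} {T : measurableType d}
    (P : probability T R) (N : nat) (exact : nat -> (nat -> R) -> R)
    (delta : nat -> {RV P >-> R}) : Prop :=
  forall k : nat, (1 <= k <= N)%N ->
    (forall t : T, exact k (fun j => delta j t) = 0 -> delta k t = 0) /\
    (forall (e : nat -> R) (w : R),
       let past := [set t | forall j, (1 <= j < k)%N -> delta j t = e j] in
       P (past `&` [set t | exact k (fun j => delta j t) * (1 + delta k t) = w])
       = ((sr_prob (exact k e) w)%:E * P past)%E).

End FloatingPoint.

Section InnerProduct.
Context {R : realType} (a b : nat -> R).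

(* The computed partial sum of the first i products, with errors e. *)
Fixpoint dot_hat (e : nat -> R) (i : nat) : R :=
  match i with
  | 0 => 0
  | 1 => a 1%N * b 1%N * (1 + e 1%N)
  | i'.+1 => (dot_hat e i' + a i * b i * (1 + e (2 * i - 2)%N))
             * (1 + e (2 * i - 1)%N)
  end.

(* Operations 1 and 2i-2 are the products a_1 b_1 and a_i b_i, and operation
   2i-1 is the ith addition, for i >= 2; in all cases i = k./2 + 1. *)
Definition dot_exact (k : nat) (e : nat -> R) : R :=
  let i := k./2.+1 in
  if (k == 1)%N || ~~ odd k then a i * b i
  else dot_hat e i.-1 + a i * b i * (1 + e k.-1).

End InnerProduct.

Definition gamma {R : realType} (n : nat) (x : R) : R := (1 + x) ^+ n - 1.

(* Main.v *)
(* The rounding errors take finitely many values almost surely, so expectations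
   are finite iterated means along the tree of rounding outcomes, each outcome
   pair having mean zero and second moment at most u^2 (the gap between
   neighbouring floats around x being at most u |x|). With s_i the exact and
   S_i the computed partial sums, c_i = a_i b_i and A_i = sum_(j <= i) |c_j|,
   averaging over the two roundings of step i makes the error S_i - s_i centred
   and gives, for V_i = E (S_i - s_i)^2,
     V_i <= (1 + u^2) (V_(i-1) + c_i^2 u^2) + u^2 s_i^2,
   from which V_i <= A_i^2 ((1 + u^2)^i - 1) follows by induction, using
   s_i^2 <= A_i^2 and A_(i-1)^2 + c_i^2 <= A_i^2. *)
Require Import Defs.
From mathcomp Require Import all_boot all_order all_algebra.
From mathcomp Require Import all_classical all_reals all_analysis.
From mathcomp Require Import measurable_realfun ring.
Import Order.TTheory GRing.Theory Num.Theory.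
Local Open Scope ring_scope.

(** * Rounding to adjacent floats *)

(** The exponent is the floor of [ln x / ln b]. *)
Lemma exprz_itv {R : realType} {b x : R} : 1 < b -> 0 < x ->
  exists e : int, b ^ e <= x < b ^ (e + 1).
Proof.
move=> b1 x0; have b0 : 0 < b by apply: lt_trans b1.
have lb : 0 < ln b by rewrite ln_gt0.
have powE (z : int) : b ^ z = expR (z%:~R * ln b).
  by rewrite -powR_intmul ?ltW// /powR gt_eqF.
have := floor_itv (ln x / ln b); set e := Num.floor _ => /andP[el er].
exists e; rewrite !powE -{1 2}(lnK x0) ler_expR ltr_expR.
by rewrite -ler_pdivlMr// el -ltr_pdivrMr// er.
Qed.

Section Rounding.
Context {R : realType} {beta p : nat}.
Hypotheses (beta_gt1 : (1 < beta)%N) (p_gt0 : (0 < p)%N).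
Local Notation b := (beta%:R : R).
Local Notation F := (@float R beta p).
Local Notation u := (@unit_roundoff R beta p).

Let b_gt1 : 1 < b. Proof. by rewrite ltr1n. Qed.
Let b_gt0 : 0 < b. Proof. by apply: lt_trans b_gt1. Qed.
Let b_neq0 : b != 0. Proof. by rewrite gt_eqF. Qed.

Lemma floatN {x : R} : F x -> F (- x).
Proof.
move=> [m [e [mb xE]]]; exists m, e; split => //.
by case: xE => ->; [right | left; rewrite opprK].
Qed.

(** In units of the spacing [b^(z-p)], the end points of a binade become integers, so comparisons
    with them reduce to comparisons of significands. *)
Let expb_pred_p (z : int) : b ^ (z - 1) = (beta ^ p.-1)%N%:R * b ^ (z - p%:Z).
Proof.
rewrite natrX exprnP -expfzDr //; congr (_ ^ _).
by rewrite predn_int //; ring.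
Qed.

Let expb_p (z : int) : b ^ z = (beta ^ p)%N%:R * b ^ (z - p%:Z).
Proof. by rewrite natrX exprnP -expfzDr //; congr (_ ^ _); ring. Qed.

Lemma float_gt0_itv {y : R} : F y -> 0 < y ->
  exists (m : nat) (f : int),
    y = m%:R * b ^ (f - p%:Z) /\ b ^ (f - 1) <= y < b ^ f.
Proof.
move=> [m [f [/andP[m1 m2] yE]]] y0; exists m, f.
have bf0 : 0 < b ^ (f - p%:Z) by rewrite exprz_gt0.
have {}yE : y = m%:R * b ^ (f - p%:Z).
  case: yE => // yE; move: y0; rewrite yE oppr_gt0 ltNge.
  by rewrite mulr_ge0// ltW.
split => //; rewrite yE expb_pred_p (expb_p f).
by rewrite ler_pM2r// ltr_pM2r// ler_nat ltr_nat m1 m2.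
Qed.

(* Floats in the closed binade [b^(e-1), b^e] are the integer multiples of
   b^(e-p), the right end point being the first float of the next binade. *)
Lemma float_binade (m : nat) (e : int) : (beta ^ p.-1 <= m <= beta ^ p)%N ->
  F (m%:R * b ^ (e - p%:Z)).
Proof.
move=> /andP[m1]; rewrite leq_eqVlt => /predU1P[->|m2]; last first.
  by exists m, e; rewrite m1 m2; split => //; left.
exists (beta ^ p.-1)%N, (e + 1); rewrite leqnn ltn_exp2l// prednK// leqnn.
by split => //; left; rewrite -expb_p -expb_pred_p addrK.
Qed.

Definition adjacent_floats (x lo hi : R) :=
  [/\ F lo, F hi, lo < x < hi & forall y, F y -> y <= lo \/ hi <= y].

(** In the binade [b^(e-1) <= x < b^e] the floats are spaced by [ulp = b^(e-p)], so the neighbours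
    of [x] are the integer part of [x / ulp] and its successor, times [ulp]. The gap is
    [ulp = u b^(e-1) <= u x]. *)
Lemma adjacent_floats_gt0 {x : R} : 0 < x -> ~ F x ->
  exists lo hi, adjacent_floats x lo hi /\ hi - lo <= u * x.
Proof.
move=> x0 xF; have [e /andP[xl xr]] : exists e : int, b ^ (e - 1) <= x < b ^ e.
  by have [e xe] := exprz_itv b_gt1 x0; exists (e + 1); rewrite addrK.
pose ulp := b ^ (e - p%:Z).
have ulp0 : 0 < ulp by rewrite exprz_gt0.
have z0 : 0 <= x / ulp by rewrite divr_ge0// ltW.
have /andP[] := truncn_itv z0; set m := Num.trunc _ => ml mr.
rewrite ler_pdivlMr// in ml; rewrite ltr_pdivrMr// in mr.
have m1 : (beta ^ p.-1 <= m)%N.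
  rewrite -ltnS -(ltr_nat R) -(ltr_pM2r ulp0) -expb_pred_p.
  exact: le_lt_trans xl mr.
have m2 : (m < beta ^ p)%N.
  rewrite -(ltr_nat R) -(ltr_pM2r ulp0) -expb_p.
  exact: le_lt_trans ml xr.
have Flo : F (m%:R * ulp) by apply: float_binade; rewrite m1 ltnW.
exists (m%:R * ulp), (m.+1%:R * ulp); split; last first.
  rewrite -mulrBl -natrB// subSnn mul1r /ulp.
  have -> : e - p%:Z = (1 - p%:Z) + (e - 1) by ring.
  by rewrite expfzDr// ler_pM2l// exprz_gt0.
split => //.
- by apply: float_binade; rewrite m2 (leq_trans m1).
- rewrite mr andbT lt_neqAle ml andbT; apply/eqP => xE.
  by apply: xF; rewrite -xE.
move=> y Fy; have [y0|y0] := leP y 0.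
  by left; apply: le_trans y0 _; rewrite mulr_ge0// ltW.
have [k [f [yE /andP[yl yr]]]] := float_gt0_itv Fy y0.
(* A float of a lower binade is at most [b^(e-1)], hence below [m ulp]. One of the same or a higher
   binade is an integer multiple of [ulp], so it cannot fall strictly between [m ulp] and
   [(m+1) ulp]. *)
have [ef|fe] := leP e f; last first.
  left; apply: le_trans (ltW yr) _; apply: (@le_trans _ _ (b ^ (e - 1))).
    by apply: ler_weXz2l; [exact: ltW | rewrite lerBrDr lezD1].
  by rewrite expb_pred_p ler_pM2r// ler_nat.
have {}yE : y = (k * beta ^ `|f - e|%N)%N%:R * ulp.
  rewrite natrM natrX exprnP -mulrA -expfzDr// yE; congr (_ * _ ^ _).
  by rewrite gez0_abs ?subr_ge0// addrA subrK.
by rewrite yE !ler_pM2r// !ler_nat; apply/orP; case: leqP.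
Qed.

Lemma adjacent_floatsN {x lo hi : R} :
  adjacent_floats (- x) lo hi -> adjacent_floats x (- hi) (- lo).
Proof.
move=> [Flo Fhi /andP[lx xh] gap]; split; [exact: floatN|exact: floatN| |].
  by rewrite ltrNl xh ltrNr lx.
by move=> y /floatN /gap[?|?]; [right; rewrite lerNl|left; rewrite lerNr].
Qed.

Lemma adjacent_floatsP {x : R} : x != 0 -> ~ F x ->
  exists lo hi, adjacent_floats x lo hi /\ hi - lo <= u * `|x|.
Proof.
move=> x0 xF; have /orP[xlt0|xgt0] := lt_total x0.
- have [| |lo [hi [adj le_gap]]] := @adjacent_floats_gt0 (- x).
  + by rewrite oppr_gt0.
  + by move=> /floatN; rewrite opprK.
  exists (- hi), (- lo); split; first exact: adjacent_floatsN.
  by rewrite opprK addrC ltr0_norm.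
- have [lo [hi [adj le_gap]]] := adjacent_floats_gt0 xgt0 xF.
  by exists lo, hi; rewrite gtr0_norm.
Qed.

(** The extrema exist and are unique by antisymmetry, which forces the choice made by [xget] and
    rules out its default 0. *)
Lemma adjacent_round {x lo hi : R} : adjacent_floats x lo hi ->
  round_down beta p x = lo /\ round_up beta p x = hi.
Proof.
move=> [Flo Fhi /andP[lx xh] gap]; split; apply: xget_unique.
- split; first by split => //; exact: ltW.
  move=> y [Fy yx]; have [//|hy] := gap y Fy.
  by have := lt_le_trans xh (le_trans hy yx); rewrite ltxx.
- move=> y [[Fy yx] maxy]; have [yl|hy] := gap y Fy.
    by apply/eqP; rewrite eq_le yl; apply: maxy; split => //; exact: ltW.
  by have := lt_le_trans xh (le_trans hy yx); rewrite ltxx.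
- split; first by split => //; exact: ltW.
  move=> y [Fy yx]; have [yl|//] := gap y Fy.
  by have := lt_le_trans lx (le_trans yx yl); rewrite ltxx.
- move=> y [[Fy yx] miny]; have [yl|hy] := gap y Fy.
    by have := lt_le_trans lx (le_trans yx yl); rewrite ltxx.
  by apply/eqP; rewrite eq_le hy andbT; apply: miny; split => //; exact: ltW.
Qed.

Lemma round_itv {x : R} : x != 0 -> ~ F x ->
  round_down beta p x < x < round_up beta p x /\
  round_up beta p x - round_down beta p x <= u * `|x|.
Proof.
move=> x0 xF; have [lo [hi [adj gap]]] := adjacent_floatsP x0 xF.
by have [-> ->] := adjacent_round adj; case: adj.
Qed.

End Rounding.

(** * Means over the tree of rounding outcomes *)

Section RoundingMeanDef.
Context {R : realType} (beta p : nat).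
Local Notation F := (@float R beta p).

(* The mean of g (delta), where delta is the relative error committed when
   rounding x. *)
Definition round_mean (x : R) (g : R -> R) : R :=
  if x \in (F `|` [set 0])%classic then g 0 else
  theta beta p x * g (round_up beta p x / x - 1) +
  (1 - theta beta p x) * g (round_down beta p x / x - 1).

Definition update (e : nat -> R) (k : nat) (v : R) : nat -> R :=
  fun j => if j == k then v else e j.

Definition past_determined (k : nat) (f : (nat -> R) -> R) : Prop :=
  forall e e', (forall j, (1 <= j < k)%N -> e j = e' j) -> f e = f e'.

(* The conditional expectation of f (delta) given delta 1, ..., delta k.-1,
   where f reads at most delta 1, ..., delta k. *)
Definition step_mean (exact : nat -> (nat -> R) -> R) (k : nat)
    (f : (nat -> R) -> R) : (nat -> R) -> R :=
  fun e => round_mean (exact k e) (fun v => f (update e k v)).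

(** The tower rule taken as a definition: rounding [k + m - 1] is averaged first, rounding [k]
    last. *)
Definition path_mean (exact : nat -> (nat -> R) -> R) (k m : nat)
    (f : (nat -> R) -> R) : (nat -> R) -> R :=
  foldr (step_mean exact) f (iota k m).

End RoundingMeanDef.

Section RoundingMean.
Context {R : realType} {beta p : nat}.
Hypotheses (beta_gt1 : (1 < beta)%N) (p_gt0 : (0 < p)%N).
Local Notation F := (@float R beta p).
Local Notation u := (@unit_roundoff R beta p).
Local Notation round_mean := (@round_mean R beta p).
Local Notation step_mean := (@step_mean R beta p).
Local Notation path_mean := (@path_mean R beta p).

Variant round_mean_spec (x : R) : Prop :=
| RoundMeanExact of x \in (F `|` [set 0])%classic
    & forall g, round_mean x g = g 0
| RoundMeanInexact of x \notin (F `|` [set 0])%classic & x != 0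
    & 0 < theta beta p x < 1
    & round_down beta p x < round_up beta p x
    & forall g, round_mean x g =
        theta beta p x * g (round_up beta p x / x - 1) +
        (1 - theta beta p x) * g (round_down beta p x / x - 1).

Lemma round_meanP (x : R) : round_mean_spec x.
Proof.
have [xF|xF] := boolP (x \in (F `|` [set 0])%classic).
  by constructor => // g; rewrite /round_mean xF.
have x0 : x != 0.
  by apply: contra xF => /eqP ->; rewrite inE; right.
have nFx : ~ F x by move=> Fx; move/negP: xF; apply; rewrite inE; left.
have [/andP[lx xh] _] := round_itv beta_gt1 p_gt0 x0 nFx.
have lh := lt_trans lx xh.
apply: RoundMeanInexact => //; last by move=> g; rewrite /round_mean (negPf xF).
by rewrite /theta divr_gt0 ?subr_gt0//= ltr_pdivrMr ?subr_gt0// mul1r ltrD2r.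
Qed.

Lemma round_mean_linear (x a b c : R) (f g : R -> R) :
  round_mean x (fun v => a * f v + b * g v + c) =
  a * round_mean x f + b * round_mean x g + c.
Proof. by case: (round_meanP x) => [_|_ _ _ _] mE; rewrite !mE//; ring. Qed.

Lemma ler_round_mean (x : R) (f g : R -> R) : (forall v, f v <= g v) ->
  round_mean x f <= round_mean x g.
Proof.
move=> fg; case: (round_meanP x) => [_|_ _ /andP[t0 t1] _] mE; rewrite !mE//.
by apply: lerD; apply: ler_wpM2l; rewrite ?subr_ge0 ?(ltW t0) ?(ltW t1).
Qed.

(** [theta] is the weight that makes [x] the barycentre of its two neighbours. *)
Lemma round_mean_id (x : R) : round_mean x id = 0.
Proof.
case: (round_meanP x) => [_|_ x0 _ lh] -> //.
by rewrite /theta; field; rewrite x0 subr_eq0 gt_eqF.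
Qed.

(** For an inexact [x] the second moment equals [(hi - x)(x - lo) / x^2], and both factors are at
    most the gap [hi - lo <= u |x|]. *)
Lemma round_mean_sqr_le (x : R) : round_mean x (fun v => v ^+ 2) <= u ^+ 2.
Proof.
case: (round_meanP x) => [_|xF x0 _ lh] ->; first by rewrite expr0n sqr_ge0.
have nFx : ~ F x by move=> Fx; move/negP: xF; apply; rewrite inE; left.
have [/andP[lx xh] gap] := round_itv beta_gt1 p_gt0 x0 nFx.
set lo := round_down beta p x in lx gap lh *.
set hi := round_up beta p x in xh gap lh *.
have -> : theta beta p x * (hi / x - 1) ^+ 2 +
    (1 - theta beta p x) * (lo / x - 1) ^+ 2 = (hi - x) * (x - lo) / `|x| ^+ 2.
  by rewrite real_normK ?num_real// /theta -/lo -/hi; field;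
     rewrite x0 subr_eq0 gt_eqF.
rewrite ler_pdivrMr ?exprn_gt0 ?normr_gt0// -exprMn.
apply: (@le_trans _ _ ((hi - lo) ^+ 2)); last first.
  by rewrite lerXn2r ?nnegrE// ?subr_ge0 ?(ltW lh)// (le_trans _ gap)
    ?subr_ge0 ?(ltW lh).
by rewrite expr2; apply: ler_pM; rewrite ?subr_ge0 ?lerD2r ?lerD2l ?lerN2 ltW.
Qed.

Lemma round_mean_quadratic (x a b c : R) :
  round_mean x (fun v => a + b * v + c * v ^+ 2) =
  a + c * round_mean x (fun v => v ^+ 2).
Proof.
rewrite (_ : (fun _ => _) = (fun v => b * v + c * v ^+ 2 + a)); last first.
  by apply/funext => v; ring.
by rewrite round_mean_linear (round_mean_id x); ring.
Qed.

Lemma round_mean_quadratic_le (x a b c : R) : 0 <= c ->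
  round_mean x (fun v => a + b * v + c * v ^+ 2) <= a + c * u ^+ 2.
Proof.
by move=> c0; rewrite round_mean_quadratic lerD2l ler_wpM2l// round_mean_sqr_le.
Qed.

Lemma sr_prob_up {x : R} : x \notin (F `|` [set 0])%classic ->
  sr_prob beta p x (round_up beta p x) = theta beta p x.
Proof. by move=> /negPf xF; rewrite /sr_prob xF eqxx. Qed.

Lemma sr_prob_down {x : R} : x \notin (F `|` [set 0])%classic ->
  sr_prob beta p x (round_down beta p x) = 1 - theta beta p x.
Proof.
case: (round_meanP x) => [->//|_ _ _ lh _] /negPf xF.
by rewrite /sr_prob xF (lt_eqF lh) eqxx.
Qed.

(** Peels off the last rounding, whereas the definition unfolds at the first; the error recurrences
    remove the last two roundings. *)
Lemma path_meanSr exact k m f :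
  path_mean exact k m.+1 f = path_mean exact k m (step_mean exact (k + m) f).
Proof. by rewrite /path_mean -addn1 iotaD foldr_cat. Qed.

Lemma path_mean_linear exact k m (x y z : R) f g e :
  path_mean exact k m (fun e => x * f e + y * g e + z) e =
  x * path_mean exact k m f e + y * path_mean exact k m g e + z.
Proof.
elim: m k e => [//|m IH] k e; rewrite /path_mean /= {1}/step_mean.
under eq_fun do rewrite -/(path_mean _ _ _ _) IH.
by rewrite round_mean_linear.
Qed.

Lemma ler_path_mean exact k m f g e : (forall e, f e <= g e) ->
  path_mean exact k m f e <= path_mean exact k m g e.
Proof.
by move=> fg; elim: m k e => [//|m IH] k e; apply: ler_round_mean => v; apply: IH.
Qed.

End RoundingMean.

(** * From the conditional laws to expectations as iterated means *)

Lemma integral_subset_full {d} {T : measurableType d} {R : realType}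
    (P : probability T R) {A : set T} (B : set T) {f : T -> \bar R} :
  measurable A -> measurable B -> (B `<=` A)%classic -> P B = P A ->
  measurable_fun A f -> (\int[P]_(t in A) f t = \int[P]_(t in B) f t)%E.
Proof.
move=> mA mB BA PBA mf.
have mAB : measurable (A `\` B)%classic by exact: measurableD.
have AE : (B `|` (A `\` B))%classic = A by exact: setDUK.
rewrite -{1}AE integral_setU ?AE//; last by rewrite disj_set2E setDIK.
rewrite [X in (_ + X)%E](_ : _ = 0%E) ?adde0//.
apply: null_set_integral => //; first exact: measurable_funS mf.
transitivity (P A - P (A `&` B)%classic)%E.
  by apply: measureD => //; rewrite (le_lt_trans (probability_le1 _ _)) ?ltry.
by rewrite setIidr// PBA subee// fin_num_measure.
Qed.

Section ErrorProcess.
Context {R : realType} {beta p : nat}.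
Hypotheses (beta_gt1 : (1 < beta)%N) (p_gt0 : (0 < p)%N).
Context {d : measure_display} {T : measurableType d} (P : probability T R).
Context {N : nat} {exact : nat -> (nat -> R) -> R} {delta : nat -> {RV P >-> R}}.
Hypothesis exact_past : forall k, past_determined k (exact k).
Hypothesis delta_sr : sr_errors beta p N exact delta.
Local Notation F := (@float R beta p).

Definition past (k : nat) (e : nat -> R) : set T :=
  [set t | forall j, (1 <= j < k)%N -> delta j t = e j]%classic.

Lemma past1 e : past 1 e = setT.
Proof. by apply/seteqP; split => // t _ j; case: j. Qed.

Lemma past_update k e v : (0 < k)%N ->
  past k.+1 (update e k v) = (past k e `&` delta k @^-1` [set v])%classic.
Proof.
move=> k0; apply/seteqP; split=> t /=.
  move=> h; split; last by rewrite /= h ?k0 ?ltnS ?leqnn// /update eqxx.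
  move=> j /andP[j1 jk]; rewrite h; last by rewrite j1 ltnS ltnW.
  by rewrite /update ltn_eqF.
move=> [h hk] j /andP[j1]; rewrite ltnS leq_eqVlt /update => /predU1P[->|jk].
  by rewrite eqxx.
by rewrite ltn_eqF// h// j1.
Qed.

Lemma measurable_past k e : measurable (past k e).
Proof.
elim: k => [|[_|k IH]].
- by rewrite (_ : past 0 e = setT)//; apply/seteqP; split => // t _ [].
- by rewrite past1.
rewrite (_ : e = update e k.+1 (e k.+1)); last first.
  by apply/funext => j; rewrite /update; case: eqP => [->|].
by rewrite past_update//; apply: measurableI.
Qed.

Lemma past_exact {k e t} : past k e t -> exact k (fun j => delta j t) = exact k e.
Proof. exact: exact_past. Qed.

(** For a nonzero exact result, the rounded value is [w] exactly when the error is
    [w / exact k e - 1]; this turns the law of the value into that of the error. *)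
Lemma prob_past_update {k e} w : (1 <= k <= N)%N -> exact k e != 0 ->
  P (past k.+1 (update e k (w / exact k e - 1))) =
  ((sr_prob beta p (exact k e) w)%:E * P (past k e))%E.
Proof.
move=> kN x0; have [_ <-] := delta_sr _ kN; congr (P _).
rewrite past_update; last by case/andP: kN.
apply/seteqP; split => t /= [et]; rewrite (past_exact et) => h.
  by split => //; rewrite h; field.
by split => //; rewrite -h; field.
Qed.

Lemma past_update0 {k e} : (1 <= k <= N)%N -> exact k e = 0 ->
  past k.+1 (update e k 0) = past k e.
Proof.
move=> kN x0; rewrite past_update; last by case/andP: kN.
apply/setIidPl => t et; have [d0 _] := delta_sr _ kN.
by apply: d0; rewrite (past_exact et).
Qed.

(** A zero result gives error 0 everywhere, by convention; a nonzero float gives it only almost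
    surely, through [sr_prob]. *)
Lemma prob_past_update_exact {k e} : (1 <= k <= N)%N ->
  exact k e \in (F `|` [set 0])%classic ->
  P (past k.+1 (update e k 0)) = P (past k e).
Proof.
move=> kN xF; have [x0|x0] := eqVneq (exact k e) 0.
  by rewrite past_update0.
have := prob_past_update (exact k e) kN x0.
by rewrite divff// subrr /sr_prob xF eqxx mul1e.
Qed.

(* Up to a null event, an event fixing the first errors is split by the outcome
   of the next rounding into one or two events of the same kind. *)
Lemma integral_past (f : (nat -> R) -> R) :
  past_determined N.+1 f ->
  measurable_fun setT (fun t => f (fun j => delta j t)) ->
  forall m k e, (0 < k)%N -> (k + m = N.+1)%N ->
  (\int[P]_(t in past k e) (f (fun j => delta j t))%:E =
   P (past k e) * (path_mean beta p exact k m f e)%:E)%E.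
Proof.
move=> f_past mf; elim=> [|m IH] k e k0 kN.
  (* No rounding remains: every error read by [f] is fixed, so the integrand is constant. *)
  rewrite addn0 in kN; rewrite kN /path_mean /= muleC.
  under eq_integral => t.
    rewrite inE => et; rewrite (f_past _ e et); over.
  by rewrite integral_cst//; exact: measurable_past.
have kleN : (1 <= k <= N)%N by rewrite k0 -ltnS -kN addnS ltnS leq_addr.
have {}IH v : (\int[P]_(t in past k.+1 (update e k v))
    (f (fun j => delta j t))%:E = P (past k.+1 (update e k v)) *
    (path_mean beta p exact k.+1 m f (update e k v))%:E)%E.
  by apply: IH => //; rewrite addSnnS.
have mfE A : measurable_fun A (fun t => (f (fun j => delta j t))%:E).
  by apply: measurable_funTS; exact/measurable_EFinP.
have sub v : (past k.+1 (update e k v) `<=` past k e)%classic.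
  by rewrite past_update//; exact: subIsetl.
rewrite /path_mean /= {1}/step_mean -/(path_mean _ _ _ _ _ _).
have [xF|xF x0 _ lh] := round_meanP beta_gt1 p_gt0 (exact k e) => ->.
  rewrite -(prob_past_update_exact kleN xF) -IH.
  apply: integral_subset_full; rewrite ?prob_past_update_exact//;
    exact: measurable_past.
set x := exact k e in xF x0 lh *.
set hi := round_up beta p x in lh *; set lo := round_down beta p x in lh *.
(* [B w] is the event that the past is [e] and [x] is rounded to [w]. The events for [hi] and [lo]
   are disjoint, and their weights [theta] and [1 - theta] exhaust the mass of [past k e]. *)
pose B w := past k.+1 (update e k (w / x - 1)).
have mB w : measurable (B w) by exact: measurable_past.
have PB w : P (B w) = ((sr_prob beta p x w)%:E * P (past k e))%E.
  exact: prob_past_update.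
have Bdisj : (B hi `&` B lo)%classic = set0.
  rewrite -subset0 => t; rewrite /B !past_update//.
  move=> [[_ /= ->] [_ /= /addIr /(mulIf (invr_neq0 x0)) hilo]].
  by rewrite hilo ltxx in lh.
rewrite (integral_subset_full P (B hi `|` B lo)%classic) //; first last.
- transitivity (P (B hi) + P (B lo))%E; first exact: measureU.
  rewrite !PB sr_prob_up// sr_prob_down//.
  rewrite -(fineK (fin_num_measure P _ (measurable_past k e))).
  by rewrite -!EFinM -EFinD; congr _%:E; ring.
- by move=> t [] /sub.
- exact: measurableU.
- exact: measurable_past.
rewrite integral_setU ?disj_set2E ?Bdisj ?eqxx// !IH -/(B hi) -/(B lo) !PB.
rewrite sr_prob_up// sr_prob_down//.
rewrite -(fineK (fin_num_measure P _ (measurable_past k e))).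
by rewrite -!EFinM -EFinD; congr _%:E; ring.
Qed.

Lemma expectation_path_mean (f : (nat -> R) -> R) e :
  past_determined N.+1 f ->
  measurable_fun setT (fun t => f (fun j => delta j t)) ->
  ('E_P[fun t => f (fun j => delta j t)] =
   (path_mean beta p exact 1 N f e)%:E)%E.
Proof.
move=> f_past mf; rewrite unlock.
by rewrite -(past1 e) (integral_past _ f_past mf N 1)// past1 probability_setT mul1e.
Qed.

End ErrorProcess.

(** * Error recurrence for the inner product *)

Section InnerProductError.
Context {R : realType} {beta p : nat} (a b : nat -> R).
Hypotheses (beta_gt1 : (1 < beta)%N) (p_gt0 : (0 < p)%N).
Local Notation u := (@unit_roundoff R beta p).
Local Notation exact := (dot_exact a b).
Local Notation dot i := (\sum_(1 <= j < i.+1) a j * b j).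
Local Notation absdot i := (\sum_(1 <= j < i.+1) `|a j * b j|).
Local Notation mean m f := (path_mean beta p exact 1 m f (fun=> 0)).

(** A form of the recursion free of truncated subtraction: the product has index [i.*2], the
    addition [i.*2.+1]. *)
Lemma dot_hatS e i : (0 < i)%N ->
  dot_hat a b e i.+1 =
  (dot_hat a b e i + a i.+1 * b i.+1 * (1 + e i.*2)) * (1 + e i.*2.+1).
Proof.
case: i => // i _; have E : (2 * i.+2 = i.+1.*2.+2)%N by rewrite mul2n.
rewrite -[LHS]/((dot_hat a b e i.+1 +
  a i.+2 * b i.+2 * (1 + e (2 * i.+2 - 2)%N)) * (1 + e (2 * i.+2 - 1)%N)).
by rewrite E subn1 subn2.
Qed.

(** For [i > 0] the last error read is that of the [i]th addition, of index [2i - 1]. *)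
Lemma dot_hat_past i : past_determined i.*2 (fun e => dot_hat a b e i).
Proof.
elim: i => [//|[|i] IH] e e' ee'; first by rewrite /= ee'.
have dE : dot_hat a b e i.+1 = dot_hat a b e' i.+1.
  apply: IH => j /andP[j1 ji]; apply: ee'.
  by rewrite j1 (leq_trans ji)// leq_double.
by rewrite (dot_hatS e)// (dot_hatS e')// dE !ee'//= !doubleS ltnS ?leqnn// leqnSn.
Qed.

Lemma dot_exact_past k : past_determined k (exact k).
Proof.
move=> e e' ee'; rewrite /dot_exact; case: ifP => // /negbT.
rewrite negb_or negbK => /andP[k1 kodd].
have kE : k = k./2.*2.+1 by rewrite -{1}(odd_double_half k) kodd.
have k2 : (0 < k./2)%N by move: k1; rewrite kE; case: k./2.
congr (_ + _ * (1 + _)).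
  apply: dot_hat_past => j /andP[j1 jk]; apply: ee'.
  by rewrite j1 kE ltnS ltnW.
by apply: ee'; rewrite kE /= ltnSn double_gt0 k2.
Qed.

Lemma dot_exact_mul i e : exact i.*2 e = a i.+1 * b i.+1.
Proof. by rewrite /dot_exact odd_double orbT doubleK. Qed.

Lemma dot_exact_add i e : (0 < i)%N ->
  exact i.*2.+1 e = dot_hat a b e i + a i.+1 * b i.+1 * (1 + e i.*2).
Proof.
case: i => // i _; rewrite /dot_exact /= odd_double /=.
by rewrite uphalf_double.
Qed.

Lemma dotS i : dot i.+1 = dot i + a i.+1 * b i.+1.
Proof. by rewrite big_nat_recr. Qed.

Let err i (e : nat -> R) := dot_hat a b e i - dot i.

Lemma dot_hat_update i e k v : (i.*2 <= k)%N ->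
  dot_hat a b (update e k v) i = dot_hat a b e i.
Proof.
move=> ik; apply: dot_hat_past => j /andP[_ ji]; rewrite /update ltn_eqF//.
exact: leq_trans ji ik.
Qed.

(** Kept general in [f] to serve both the mean (identity) and the second moment (square). *)
Lemma step_mean_add_err i f : (0 < i)%N ->
  step_mean beta p exact i.*2.+1 (fun e => f (err i.+1 e)) =
  fun e => let x := dot_hat a b e i + a i.+1 * b i.+1 * (1 + e i.*2) in
    round_mean beta p x (fun v => f (x * (1 + v) - dot i.+1)).
Proof.
move=> i0; apply/funext => e; rewrite /step_mean dot_exact_add//=.
congr round_mean; apply/funext => v; congr (f (_ - _)).
by rewrite dot_hatS// dot_hat_update// /update eqxx ltn_eqF.
Qed.

Lemma mean_err_rec i : (0 < i)%N ->
  mean i.*2.+1 (err i.+1) = mean i.*2.-1 (err i).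
Proof.
move=> i0; have i20 : (0 < i.*2)%N by rewrite double_gt0.
(* The first [i] terms take [2i - 1] roundings; the next term adds product [2i] and addition
   [2i + 1], both peeled off here. *)
rewrite -[X in mean X.+1 _](prednK i20) !path_meanSr add1n prednK//.
rewrite (step_mean_add_err _ (fun x => x) i0); congr (path_mean _ _ _ _ _ _ _).
apply/funext => e /=; rewrite /step_mean dot_exact_mul.
transitivity (round_mean beta p (a i.+1 * b i.+1)
    (fun v => err i e + a i.+1 * b i.+1 * v + 0 * v ^+ 2)).
  congr round_mean; apply/funext => v; set x := dot_hat _ _ _ _ + _.
  rewrite (_ : (fun w => _) = fun w => x - dot i.+1 + x * w + 0 * w ^+ 2).
    rewrite round_mean_quadratic// /x dot_hat_update// /update eqxx dotS /err.
    by ring.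
  by apply/funext => w; ring.
by rewrite round_mean_quadratic//; ring.
Qed.

Lemma mean_err i : (0 < i)%N -> mean i.*2.-1 (err i) = 0.
Proof.
elim: i => [//|[_ _|i IH _]]; last by rewrite doubleS mean_err_rec// IH.
rewrite /path_mean /= /step_mean.
rewrite (_ : (fun v => _) = fun v => 0 + a 1 * b 1 * v + 0 * v ^+ 2).
  by rewrite round_mean_quadratic//; ring.
by apply/funext => v; rewrite /err /= big_nat1 /update eqxx; ring.
Qed.

(** With [x = err i + S + c v], averaging over the addition leaves at most [(x - S)^2 + u^2 x^2], a
    quadratic in the product error [v], averaged in turn. The cross term [2 u^2 S err i] that
    remains has mean zero by [mean_err]. *)
Lemma mean_err2_rec i : (0 < i)%N ->
  mean i.*2.+1 (fun e => err i.+1 e ^+ 2) <=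
  (1 + u ^+ 2) * (mean i.*2.-1 (fun e => err i e ^+ 2) +
                  (a i.+1 * b i.+1) ^+ 2 * u ^+ 2) + u ^+ 2 * dot i.+1 ^+ 2.
Proof.
move=> i0; have i20 : (0 < i.*2)%N by rewrite double_gt0.
rewrite -[X in mean X.+1 _](prednK i20) !path_meanSr add1n prednK//.
set c := a i.+1 * b i.+1; set S := dot i.+1.
(* The zero-mean cross term is put back, so that the two sides can be compared pointwise in [e]. *)
have -> : (1 + u ^+ 2) * (mean i.*2.-1 (fun e => err i e ^+ 2) +
    c ^+ 2 * u ^+ 2) + u ^+ 2 * S ^+ 2 =
    mean i.*2.-1 (fun e => (1 + u ^+ 2) * err i e ^+ 2 +
      (2 * u ^+ 2 * S) * err i e +
      ((1 + u ^+ 2) * (c ^+ 2 * u ^+ 2) + u ^+ 2 * S ^+ 2)).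
  by rewrite path_mean_linear// mean_err//; ring.
apply: ler_path_mean => // e; rewrite {1}/step_mean dot_exact_mul -/c.
have -> : (1 + u ^+ 2) * err i e ^+ 2 + 2 * u ^+ 2 * S * err i e +
    ((1 + u ^+ 2) * (c ^+ 2 * u ^+ 2) + u ^+ 2 * S ^+ 2) =
    (err i e ^+ 2 + u ^+ 2 * (err i e + S) ^+ 2) +
    ((1 + u ^+ 2) * c ^+ 2) * u ^+ 2 by ring.
have u2 : 0 <= u ^+ 2 by rewrite sqr_ge0.
(* The explicit argument is the coefficient of [v] in [(err i + c v)^2 + u^2 (err i + S + c v)^2];
   it vanishes in the mean. *)
apply: le_trans _ (round_mean_quadratic_le beta_gt1 p_gt0 c _
  (2 * c * err i e + u ^+ 2 * (2 * c * (err i e + S))) _ _); last first.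
  by rewrite mulr_ge0 ?sqr_ge0 ?addr_ge0.
apply: ler_round_mean => // v.
rewrite (step_mean_add_err _ (fun x => x ^+ 2) i0) /= -/c -/S.
rewrite dot_hat_update// [update e _ v _]/update eqxx.
set x := dot_hat _ _ _ _ + _.
have xE : x = err i e + S + c * v by rewrite /x /err /S dotS -/c; ring.
rewrite (_ : (fun w => _) =
    fun w => (x - S) ^+ 2 + 2 * (x - S) * x * w + x ^+ 2 * w ^+ 2); last first.
  by apply/funext => w; ring.
apply: le_trans (round_mean_quadratic_le beta_gt1 p_gt0 _ _ _ _ (sqr_ge0 x)) _.
by rewrite xE le_eqVlt; apply/orP; left; apply/eqP; ring.
Qed.

Lemma mean_err2 i : (0 < i)%N ->
  mean i.*2.-1 (fun e => err i e ^+ 2) <= absdot i ^+ 2 * gamma i (u ^+ 2).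
Proof.
have u2 : 0 <= u ^+ 2 by rewrite sqr_ge0.
rewrite /gamma; set q := u ^+ 2 in u2 *.
have q1 : 1 <= 1 + q by rewrite lerDl.
have Sq1 m : 0 <= (1 + q) ^+ m - 1 by rewrite subr_ge0 exprn_ege1.
elim: i => [//|[_ _|i IH _]].
  rewrite /path_mean /= /step_mean big_nat1 real_normK ?num_real//.
  rewrite (_ : (fun v => _) = fun v => 0 + 0 * v + (a 1 * b 1) ^+ 2 * v ^+ 2).
    apply: le_trans (round_mean_quadratic_le beta_gt1 p_gt0 _ _ _ _ _) _ => //.
      exact: sqr_ge0.
    by rewrite add0r expr1 [1 + q]addrC addrK.
  by apply/funext => v; rewrite /err /= big_nat1 /update eqxx; ring.
rewrite doubleS; apply: le_trans (mean_err2_rec _ _) _ => //; rewrite -/q.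
set c := a i.+2 * b i.+2; rewrite [absdot i.+2]big_nat_recr//= -/c.
have A0 : 0 <= absdot i.+1 by apply: sumr_ge0.
have S2 : dot i.+2 ^+ 2 <= (absdot i.+1 + `|c|) ^+ 2.
  rewrite -(real_normK (num_real (dot _))) lerXn2r ?nnegrE ?addr_ge0//.
  by rewrite dotS -/c (le_trans (ler_normD _ _))// lerD2r ler_norm_sum.
have Ac : absdot i.+1 ^+ 2 + c ^+ 2 <= (absdot i.+1 + `|c|) ^+ 2.
  rewrite sqrrD real_normK ?num_real// lerD2r lerDl.
  by rewrite mulrn_wge0// mulr_ge0.
set A := absdot i.+1 in A0 S2 Ac IH *; set B := (A + `|c|) ^+ 2 in S2 Ac *.
set V := mean _ _ in IH *.
(* The target is split to match the two summands of the recurrence. *)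
have -> : B * ((1 + q) ^+ i.+2 - 1) =
  (1 + q) * (B * ((1 + q) ^+ i.+1 - 1)) + q * B by rewrite [_ ^+ i.+2]exprS; ring.
apply: lerD; last by rewrite ler_wpM2l.
rewrite ler_wpM2l ?(le_trans ler01)//.
apply: le_trans (lerD (IH isT) (lexx _)) _.
(* The product error term is absorbed by [q <= (1 + q)^(i+1) - 1]. *)
apply: (@le_trans _ _ ((A ^+ 2 + c ^+ 2) * ((1 + q) ^+ i.+1 - 1))).
  rewrite mulrDl lerD2l ler_wpM2l ?sqr_ge0//.
  by rewrite exprS mulrDl mul1r addrAC ler_wpDl// ler_peMr// exprn_ege1.
by rewrite ler_wpM2r.
Qed.

End InnerProductError.

(** * Transfer to the random variable [yhat] *)

Lemma measurable_dot_hat {R : realType} {d : measure_display}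
    {T : measurableType d} (P : probability T R) (a b : nat -> R)
    (delta : nat -> {RV P >-> R}) (i : nat) :
  measurable_fun setT (fun t => dot_hat a b (fun k => delta k t) i).
Proof.
have m1d k : measurable_fun setT (fun t => 1 + delta k t).
  exact: measurable_funD.
elim: i => [|[_|i IH]]; first exact: measurable_cst.
  exact: measurable_funM.
by apply: measurable_funM => //; apply: measurable_funD => //;
  exact: measurable_funM.
Qed.

Theorem theorem3p2 (R : realType) (beta p : nat) (hbeta : (2 <= beta)%N)
    (hp : (1 <= p)%N) (d : measure_display) (T : measurableType d)
    (P : probability T R) (n : nat) (hn : (1 <= n)%N) (a b : nat -> R)
    (delta : nat -> {RV P >-> R})
    (hdelta : sr_errors beta p (2 * n - 1) (dot_exact a b) delta) :
  let y : R := \sum_(1 <= i < n.+1) a i * b i in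
  let yhat : T -> R := fun t => dot_hat a b (fun k => delta k t) n in
  let K1 : R := (\sum_(1 <= i < n.+1) `|a i * b i|)
                / `|\sum_(1 <= i < n.+1) a i * b i| in
  let u : R := unit_roundoff beta p in
  y != 0 ->
  ('E_P[yhat] = y%:E /\
   'V_P[yhat] <= (y ^+ 2 * K1 ^+ 2 * gamma n (u ^+ 2))%:E)%E.
Proof.
move=> y yhat K1 u y0.
have N1 : (2 * n - 1)%N = n.*2.-1 by rewrite mul2n subn1.
have NS : (2 * n - 1).+1 = n.*2 by rewrite N1 prednK// double_gt0.
(* Used with the identity for the expectation and with [(x - y)^2] for the variance. *)
have mean_f (g : R -> R) : measurable_fun setT g ->
    ('E_P[fun t => g (yhat t)] =
     (path_mean beta p (dot_exact a b) 1 n.*2.-1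
        (fun e => g (dot_hat a b e n)) (fun=> 0))%:E)%E.
  move=> mg; rewrite -N1.
  apply: (expectation_path_mean hbeta hp P (dot_exact_past a b) hdelta
    (fun e => g (dot_hat a b e n))) => [|/=].
    by rewrite NS => e e' /dot_hat_past ->.
  exact: measurableT_comp mg (measurable_dot_hat P a b delta n).
have Ey : ('E_P[yhat] = y%:E)%E.
  rewrite (mean_f id)//; congr _%:E; apply/eqP; rewrite -subr_eq0; apply/eqP.
  rewrite -[RHS](mean_err a b hbeta hp n hn).
  have := path_mean_linear hbeta hp (dot_exact a b) 1 n.*2.-1 1 0 (- y)
    (fun e => dot_hat a b e n) (fun=> 0) (fun=> 0).
  rewrite mul1r !mul0r addr0 => <-; congr path_mean; apply/funext => e.
  by rewrite mul1r addr0.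
split=> //; rewrite /variance unlock Ey /=.
rewrite [X in ('E_P[X])%E](_ : _ = fun t => (yhat t - y) ^+ 2)//.
rewrite (mean_f (fun x => (x - y) ^+ 2)); last first.
  by apply: measurable_funX; exact: measurable_funB.
rewrite lee_fin (le_trans (mean_err2 a b hbeta hp n hn))// /K1 -/y.
(* As [y] is nonzero, [K1 |y|] is the sum of the [|a_i b_i|]. *)
by rewrite -(real_normK (num_real y)) -exprMn [`|y| * _]mulrC divfK// normr_eq0.
Qed.
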